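(* Let $V=\{1,\dots,n\}$, let $1\le t\le n$, let $\mathcal B$ be a set of subsets of $V$ and let $w:\mathcal B\to\mathbb R_{>0}$. Assume that $(V,\mathcal B,w)$ is both $t$-wise balanced and $(t-1)$-wise balanced, and for $j\in\{t-1,t\}$ let $\lambda_j$ be the constant value of $\sum_{B\in\mathcal B,\ Z\subset B}w(B)$ over all $j$-element subsets $Z\subset V$. Assume that every block in $\mathcal B$ has size $r_1$ or $r_2$, where $r_1\neq r_2$, put $\mathcal B_{r_\nu}=\{B\in\mathcal B: |B|=r_\nu\}$ for $\nu=1,2$, and assume that $w$ is equal to a constant $w_{r_\nu}$ on $\mathcal B_{r_\nu}$ for $\nu=1,2$. Then, for $\nu=1,2$, $(V,\mathcal B_{r_\nu})$ is a combinatorial $(t-1)$-$(n,r_\nu,\lambda^{(r_\nu)}_{t-1})$ design, with $$\lambda^{(r_1)}_{t-1}=\frac{(r_2-t+1)\lambda_{t-1}-(n-t+1)\lambda_t}{(r_2-r_1)w_{r_1}},\qquad \lambda^{(r_2)}_{t-1}=\frac{(r_1-t+1)\lambda_{t-1}-(n-t+1)\lambda_t}{(r_1-r_2)w_{r_2}}.$$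
   Context: For a set $\mathcal B$ of subsets of $V=\{1,\dots,n\}$ with positive weight function $w$, $(V,\mathcal B,w)$ is called $j$-wise balanced if the sum $\sum_{B\in\mathcal B,\ Z\subset B}w(B)$ is the same constant $\lambda_j$ for all $j$-element subsets $Z\subset V$. A combinatorial $s$-$(n,k,\lambda)$ design is a pair $(V,\mathcal B)$ with $|V|=n$ and $\mathcal B$ a set of $k$-element subsets of $V$ (blocks) such that every $s$-element subset of $V$ is contained in exactly $\lambda$ blocks ($\lambda=0$ is allowed). *)

(* Defs.v *)
From mathcomp Require Import all_boot all_order all_algebra.
From mathcomp Require Import reals.

Set Implicit Arguments.
Unset Strict Implicit.
Unset Printing Implicit Defensive.

Import Order.TTheory GRing.Theory Num.Theory.
Local Open Scope ring_scope.

(* The point set {1, ..., n} is represented by 'I_n; weights are total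
   functions on {set 'I_n}, of which only the values on blocks matter. *)

Definition wise_balanced (R : realType) (n : nat) (Bs : {set {set 'I_n}})
    (w : {set 'I_n} -> R) (j : nat) (lam : R) : Prop :=
  forall Z : {set 'I_n}, #|Z| = j ->
    \sum_(B in Bs | Z \subset B) w B = lam.

Definition combinatorial_design (n : nat) (Bs : {set {set 'I_n}})
    (s k lam : nat) : Prop :=
  (forall B : {set 'I_n}, B \in Bs -> #|B| = k) /\
  (forall Z : {set 'I_n}, #|Z| = s ->
     #|[set B in Bs | Z \subset B]| = lam).

Definition blocks_of_size (n : nat) (Bs : {set {set 'I_n}}) (r : nat) :
    {set {set 'I_n}} :=
  [set B in Bs | #|B| == r].

(* Main.v *)
(* Count the pairs (x, B) with x outside a fixed (t-1)-set Z and x |: Z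
   contained in B, each weighted by w B: this gives
   sum_(B containing Z) (|B| - t + 1) w B = (n - t + 1) lam_t.
   Subtracting it from (r2 - t + 1) times the (t-1)-balance equation kills the
   blocks of size r2 and leaves (r2 - r1) w1 times the number of blocks of size
   r1 that contain Z, which is therefore independent of Z. *)

Require Import Defs.
From mathcomp Require Import all_boot all_order all_algebra.
From mathcomp Require Import reals.

Set Implicit Arguments.
Unset Strict Implicit.
Unset Printing Implicit Defensive.

Import Order.TTheory GRing.Theory Num.Theory.
Local Open Scope ring_scope.

(** After the sums are exchanged, a block [B] containing [Z] is met once for each point of
    [B :\: Z]; the subtraction in [nat] is exact because [Z \subset B]. *)
Lemma sum_weight_extensions (V : nmodType) (T : finType)
    (Bs : {set {set T}}) (w : {set T} -> V) (Z : {set T}) :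
  \sum_(x in ~: Z) \sum_(B in Bs | x |: Z \subset B) w B =
  \sum_(B in Bs | Z \subset B) w B *+ (#|B| - #|Z|).
Proof.
rewrite (exchange_big_dep (fun B => (B \in Bs) && (Z \subset B))) /=; last first.
  by move=> x B _ /andP[-> /(subset_trans (subsetUr _ _)) ->].
apply: eq_bigr => B /andP[BBs ZB].
rewrite sumr_const -(cardsDS ZB); congr (_ *+ _); apply: eq_card => x.
by rewrite !inE unfold_in /= subUset sub1set in_setC BBs ZB andbT.
Qed.

(** Each of the [n - t] points outside [Z] extends it to a set of size [t.+1], contributing [lam].
    From here on, [t] in the lemmas stands for the theorem's [t - 1]. *)
Lemma wise_balanced_extend (R : realType) (n t : nat) (Bs : {set {set 'I_n}})
    (w : {set 'I_n} -> R) (lam : R) (Z : {set 'I_n}) :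
  wise_balanced Bs w t.+1 lam -> #|Z| = t ->
  \sum_(B in Bs | Z \subset B) (#|B|%:R - t%:R) * w B = (n%:R - t%:R) * lam.
Proof.
move=> bal cZ.
have ltn_n : (t <= n)%N by rewrite -cZ -[n in (_ <= n)%N]card_ord max_card.
have -> : (n%:R - t%:R) * lam =
    \sum_(x in ~: Z) \sum_(B in Bs | x |: Z \subset B) w B.
  rewrite (eq_bigr (fun=> lam)) => [|x]; last first.
    by rewrite inE => xZ; apply: bal; rewrite cardsU1 xZ cZ.
  by rewrite sumr_const cardsCs setCK card_ord cZ -natrB // mulr_natl.
rewrite sum_weight_extensions; apply: eq_bigr => B /andP[_ ZB].
by rewrite cZ -natrB ?mulr_natl // -cZ subset_leq_card.
Qed.

(** One half of the theorem; the other half follows by exchanging the two sizes. *)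
Lemma two_sizes_design (R : realType) (n t : nat) (Bs : {set {set 'I_n}})
    (w : {set 'I_n} -> R) (lam_t lam_t1 : R) (r1 r2 : nat) (w1 : R) :
  (t <= n)%N ->
  (forall B : {set 'I_n}, B \in Bs -> 0 < w B) ->
  wise_balanced Bs w t.+1 lam_t -> wise_balanced Bs w t lam_t1 ->
  r1 <> r2 ->
  (forall B : {set 'I_n}, B \in Bs -> #|B| = r1 \/ #|B| = r2) ->
  (forall B : {set 'I_n}, B \in blocks_of_size Bs r1 -> w B = w1) ->
  exists l1 : nat,
    combinatorial_design (blocks_of_size Bs r1) t r1 l1 /\
    l1%:R = ((r2%:R - t%:R) * lam_t1 - (n%:R - t%:R) * lam_t)
            / ((r2%:R - r1%:R) * w1).
Proof.
move=> le_tn w_pos bal_t bal_t1 hr sizes hw1.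
set q := (_ / _).
pose c (Z : {set 'I_n}) := #|[set B in blocks_of_size Bs r1 | Z \subset B]|.
have cE (Z : {set 'I_n}) : #|Z| = t -> (c Z)%:R = q.
  move=> cZ.
  have num : (r2%:R - t%:R) * lam_t1 - (n%:R - t%:R) * lam_t =
      (r2%:R - r1%:R) * w1 * (c Z)%:R.
    rewrite -(bal_t1 _ cZ) -(wise_balanced_extend bal_t cZ) mulr_sumr -sumrB.
    (* Each summand amounts to [(r2 - #|B|) * w B], so only the blocks of size [r1] survive. *)
    rewrite (bigID (fun B : {set 'I_n} => #|B| == r1)) /= addrC big1 ?add0r.
      rewrite mulr_natr /c -sumr_const; apply: eq_big => [B|B].
        by rewrite !inE andbAC.
      case/andP=> /andP[BBs _] /eqP cB; rewrite -(hw1 B) ?inE ?BBs ?cB ?eqxx //.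
      by rewrite -mulrBl opprB addrA subrK.
    move=> B /andP[/andP[BBs _] /eqP cB].
    by case: (sizes B BBs) => // ->; rewrite subrr.
  (* w1 is unconstrained (possibly 0) when no block has size r1. *)
  rewrite /q num; have [c0|] := posnP (c Z); first by rewrite c0 mulr0 mul0r.
  rewrite card_gt0 => /set0Pn[B /setIdP[Br1 _]].
  have w1N0 : w1 != 0.
    by rewrite -(hw1 _ Br1) gt_eqF // w_pos //; case/setIdP: Br1.
  rewrite mulrAC divff ?mul1r // mulf_neq0 // subr_eq0 eqr_nat.
  by apply/eqP => r21; apply: hr.
(* Since [t <= n], some [t]-set exists; its count [c Z0] serves as the witness [l1]. *)
have [Z0 cZ0] : exists Z0 : {set 'I_n}, #|Z0| = t.
  have : (0 < #|[set A : {set 'I_n} | A \subset setT & #|A| == t]|)%N.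
    by rewrite cards_draws cardsT card_ord bin_gt0.
  by rewrite card_gt0 => /set0Pn[A]; rewrite inE => /andP[_ /eqP]; exists A.
exists (c Z0); split; last exact: cE.
split=> [B /setIdP[_ /eqP] //|Z cZ].
(* Both counts become [q] in [R], and the naturals embed injectively there. *)
by apply/eqP; rewrite -(eqr_nat R) (cE Z cZ) (cE Z0 cZ0).
Qed.

Theorem theorem3p3 (R : realType) (n t : nat) (ht1 : (1 <= t)%N)
    (htn : (t <= n)%N)
    (Bs : {set {set 'I_n}}) (w : {set 'I_n} -> R)
    (w_pos : forall B : {set 'I_n}, B \in Bs -> 0 < w B)
    (lam_t lam_t1 : R)
    (bal_t : wise_balanced Bs w t lam_t)
    (bal_t1 : wise_balanced Bs w (t - 1)%N lam_t1)
    (r1 r2 : nat) (hr : r1 <> r2)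
    (sizes : forall B : {set 'I_n}, B \in Bs -> #|B| = r1 \/ #|B| = r2)
    (w1 w2 : R)
    (hw1 : forall B : {set 'I_n}, B \in blocks_of_size Bs r1 -> w B = w1)
    (hw2 : forall B : {set 'I_n}, B \in blocks_of_size Bs r2 -> w B = w2) :
  (exists l1 : nat,
     combinatorial_design (blocks_of_size Bs r1) (t - 1)%N r1 l1 /\
     l1%:R = ((r2%:R - t%:R + 1) * lam_t1 - (n%:R - t%:R + 1) * lam_t)
             / ((r2%:R - r1%:R) * w1)) /\
  (exists l2 : nat,
     combinatorial_design (blocks_of_size Bs r2) (t - 1)%N r2 l2 /\
     l2%:R = ((r1%:R - t%:R + 1) * lam_t1 - (n%:R - t%:R + 1) * lam_t)
             / ((r1%:R - r2%:R) * w2)).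
Proof.
(* Writing the theorem's [t] as [t.+1] turns the truncated [t - 1] into [t]. *)
case: t ht1 htn bal_t bal_t1 => // t _ lt_tn bal_t; rewrite subn1 /= => bal_t1.
have natS1 (r : nat) : r%:R - t.+1%:R + 1 = r%:R - t%:R :> R.
  by rewrite -natr1 opprD addrA subrK.
rewrite !natS1; split.
- exact: two_sizes_design (ltnW lt_tn) w_pos bal_t bal_t1 hr sizes hw1.
- apply: two_sizes_design (ltnW lt_tn) w_pos bal_t bal_t1 _ _ hw2.
    by move=> r21; apply: hr.
  by move=> B /sizes[] ->; [right | left].
Qed.
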